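(* Let $d=d_1+\dots+d_l$ and let $f:\mathbb{R}^d\to\mathbb{R}$ be differentiable with $f(x)\ge f^{\inf}$ for all $x$ (some $f^{\inf}\in\mathbb{R}$), and $f(x)\le f(y)+\langle\nabla f(y),x-y\rangle+\tfrac12\langle {\bf L}(x-y),x-y\rangle$ for all $x,y$, where ${\bf L}=\mathrm{Diag}({\bf L}_1,\dots,{\bf L}_l)$ with ${\bf L}_i\in\mathbb{S}^{d_i}_{++}$. For each $i\in[l]$ let $({\bf S}_i^k)_{k\ge0}$ be i.i.d. random matrices in $\mathbb{S}^{d_i}_+$ with $\mathbb{E}[{\bf S}_i^k]={\bf I}_{d_i}$, and set ${\bf S}^k:=\mathrm{Diag}({\bf S}_1^k,\dots,{\bf S}_l^k)$. Choose ${\bf W}_i\in\mathbb{S}^{d_i}_{++}$ and scalars $\gamma_i>0$ such that $$\gamma_i\le \lambda_{\max}^{-1}\Big(\mathbb{E}\big[{\bf W}_i^{-1/2}{\bf S}_i^k{\bf W}_i{\bf L}_i{\bf W}_i{\bf S}_i^k{\bf W}_i^{-1/2}\big]\Big)\qquad\forall i\in[l].$$ Let ${\bf W}:=\mathrm{Diag}({\bf W}_1,\dots,{\bf W}_l)$, $\Gamma:=\mathrm{Diag}(\gamma_1{\bf I}_{d_1},\dots,\gamma_l{\bf I}_{d_l})$, ${\bf D}:=\Gamma{\bf W}$, fix $x^0\in\mathbb{R}^d$ and let $x^{k+1}=x^k-{\bf D}{\bf S}^k\nabla f(x^k)$. Then for every $K\ge1$, $$\frac1K\sum_{k=0}^{K-1}\mathbb{E}\Big[\|\nabla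 f(x^k)\|^2_{\Gamma{\bf W}/\det(\Gamma{\bf W})^{1/d}}\Big]\le\frac{2(f(x^0)-f^{\inf})}{\det(\Gamma{\bf W})^{1/d}\,K}.$$
   Context: $\mathbb{S}^m_{+}$ (resp. $\mathbb{S}^m_{++}$): symmetric positive semidefinite (resp. definite) $m\times m$ matrices. $\mathrm{Diag}({\bf A}_1,\dots,{\bf A}_l)$ is the block-diagonal matrix with blocks ${\bf A}_i$. $\|x\|_{{\bf Q}}^2:=\langle{\bf Q}x,x\rangle$. $\lambda_{\max}$ denotes the largest eigenvalue. All expectations are assumed finite.
   Formalization: The i.i.d. assumption is taken jointly: the block-diagonal matrices S^k are assumed mutually independent across k, with blocks in the same round possibly dependent; with independence only within each block i separately, the bound can fail. *)

(* Defs.v *)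
From HB Require Import structures.
From mathcomp Require Import all_boot all_order all_algebra.
From mathcomp Require Import all_classical all_reals all_analysis.
Set Implicit Arguments. Unset Strict Implicit. Unset Printing Implicit Defensive.
Import Order.TTheory GRing.Theory Num.Theory.
Import numFieldNormedType.Exports.
Local Open Scope classical_set_scope.
Local Open Scope ring_scope.

Section Defs.
Variable R : realType.

Definition dotv n (u v : 'cV[R]_n) : R := \sum_(j < n) u j 0 * v j 0.

Definition wnorm2 n (Q : 'M[R]_n) (x : 'cV[R]_n) : R := dotv (Q *m x) x.

Definition is_psd n (A : 'M[R]_n) : Prop :=
  A^T = A /\ forall v : 'cV[R]_n, 0 <= dotv (A *m v) v.
Definition is_pd n (A : 'M[R]_n) : Prop :=
  A^T = A /\ forall v : 'cV[R]_n, v != 0 -> 0 < dotv (A *m v) v.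

Definition lambda_max n (A : 'M[R]_n) : R := sup [set a : R | eigenvalue A a].

Definition grad n (f : 'cV[R]_n -> R) (x : 'cV[R]_n) : 'cV[R]_n :=
  \col_(j < n) ('d f x (delta_mx j 0 : 'cV[R]_n)).

Section Prob.
Context {dT : measure_display} {T : measurableType dT} (P : probability T R).

Definition Emx m n (X : T -> 'M[R]_(m, n)) : 'M[R]_(m, n) :=
  \matrix_(a, b) fine ('E_P[fun w => X w a b]).

Definition mx_event m n (X : T -> 'M[R]_(m, n)) (B : 'I_m -> 'I_n -> set R) : set T :=
  [set w | forall a b, B a b (X w a b)].

Definition random_mx m n (X : T -> 'M[R]_(m, n)) : Prop :=
  forall a b, measurable_fun setT (fun w => X w a b).

(* mutual independence of a sequence of random matrices: product rule over
   every finite family of indices, on the pi-system of Borel cylinder events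
   (which generates the sigma-algebra of each random matrix) *)
Definition mx_mutually_independent m n (Y : nat -> T -> 'M[R]_(m, n)) : Prop :=
  forall (s : seq nat) (B : nat -> 'I_m -> 'I_n -> set R),
    uniq s -> (forall k a b, measurable (B k a b)) ->
    P [set w | forall k, k \in s -> mx_event (Y k) (B k) w] =
    (\prod_(k <- s) P (mx_event (Y k) (B k)))%E.

(* two random matrices have the same distribution (equality of laws on the
   generating pi-system of Borel cylinders) *)
Definition mx_same_law m n (X Y : T -> 'M[R]_(m, n)) : Prop :=
  forall B : 'I_m -> 'I_n -> set R, (forall a b, measurable (B a b)) ->
    P (mx_event X B) = P (mx_event Y B).
End Prob.

Fixpoint iterate {T : Type} n (f : 'cV[R]_n -> R) (D : 'M[R]_n)
  (S : nat -> T -> 'M[R]_n) (x0 : 'cV[R]_n) (k : nat) (w : T) : 'cV[R]_n :=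
  match k with
  | 0 => x0
  | k'.+1 => let x := iterate f D S x0 k' w in x - D *m S k' w *m grad f x
  end.

End Defs.

(* Main.v *)
Require Import Defs.
From HB Require Import structures.
From mathcomp Require Import all_boot all_order all_algebra.
From mathcomp Require Import all_classical all_reals all_analysis.
From mathcomp Require Import measurable_realfun ring lra.
Set Implicit Arguments. Unset Strict Implicit. Unset Printing Implicit Defensive.
Import Order.TTheory GRing.Theory Num.Theory.
Import numFieldNormedType.Exports.
Local Open Scope classical_set_scope.
Local Open Scope ring_scope.

(* Smoothness at [x^k - D S^k g], with [g] the gradient at [x^k], bounds
   [f(x^{k+1})] by [f(x^k) - <D S^k g, g> + 1/2 |D S^k g|_L^2]. Since [x^k] is a
   function of [S^0, ..., S^{k-1}], it is independent of [S^k], so in expectation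
   the linear term is [|g|_D^2], while the step-size condition makes the quadratic
   term at most [1/2 |g|_D^2]: hence [E f(x^{k+1}) <= E f(x^k) - 1/2 E |g|_D^2],
   which telescopes. Integrability propagates along the iterates because a smooth
   function bounded below by [finf] satisfies [|grad f|^2 <= C (f - finf)]. *)

(** * Inner products, weighted quadratic forms and the largest eigenvalue *)

Section Dotv.
Context {R : realType}.

Lemma dotvC n (u v : 'cV[R]_n) : dotv u v = dotv v u.
Proof. by apply: eq_bigr => j _; rewrite mulrC. Qed.

Lemma dotvDl n (u u' v : 'cV[R]_n) : dotv (u + u') v = dotv u v + dotv u' v.
Proof. by rewrite -big_split; apply: eq_bigr => j _; rewrite mxE mulrDl. Qed.

Lemma dotvZl n (a : R) (u v : 'cV[R]_n) : dotv (a *: u) v = a * dotv u v.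
Proof. by rewrite mulr_sumr; apply: eq_bigr => j _; rewrite mxE mulrA. Qed.

Lemma dotvDr n (u v v' : 'cV[R]_n) : dotv u (v + v') = dotv u v + dotv u v'.
Proof. by rewrite dotvC dotvDl !(dotvC u). Qed.

Lemma dotvZr n (a : R) (u v : 'cV[R]_n) : dotv u (a *: v) = a * dotv u v.
Proof. by rewrite dotvC dotvZl dotvC. Qed.

Lemma dotvNl n (u v : 'cV[R]_n) : dotv (- u) v = - dotv u v.
Proof. by rewrite -scaleN1r dotvZl mulN1r. Qed.

Lemma dotvNr n (u v : 'cV[R]_n) : dotv u (- v) = - dotv u v.
Proof. by rewrite dotvC dotvNl dotvC. Qed.

Lemma dotvE n (u v : 'cV[R]_n) : dotv u v = (u^T *m v) 0 0.
Proof. by rewrite mxE; apply: eq_bigr => j _; rewrite mxE. Qed.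

Lemma dotv_mull m n (A : 'M[R]_(m, n)) (u : 'cV_n) (v : 'cV_m) :
  dotv (A *m u) v = dotv u (A^T *m v).
Proof. by rewrite !dotvE trmx_mul mulmxA. Qed.

Lemma dotv_ge0 n (u : 'cV[R]_n) : 0 <= dotv u u.
Proof. by apply: sumr_ge0 => j _; exact: sqr_ge0. Qed.

Lemma dotv_gt0 n (u : 'cV[R]_n) : u != 0 -> 0 < dotv u u.
Proof.
move=> u0; rewrite lt_neqAle dotv_ge0 andbT eq_sym; apply: contra u0 => /eqP u0.
apply/eqP/colP => j; rewrite mxE; apply/eqP; rewrite -(@sqrf_eq0 R) expr2.
apply/eqP; apply: (psumr_eq0P _ u0) => // i _; exact: sqr_ge0.
Qed.

Lemma wnorm2E n (Q : 'M[R]_n) v :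
  wnorm2 Q v = \sum_i \sum_j Q i j * (v j 0 * v i 0).
Proof.
apply: eq_bigr => i _; rewrite mxE mulr_suml.
by apply: eq_bigr => j _; rewrite mulrA.
Qed.

Lemma wnorm2Z n (Q : 'M[R]_n) (a : R) v : wnorm2 Q (a *: v) = a ^+ 2 * wnorm2 Q v.
Proof. by rewrite /wnorm2 -scalemxAr dotvZl dotvZr mulrA expr2. Qed.

Lemma wnorm2N n (Q : 'M[R]_n) v : wnorm2 Q (- v) = wnorm2 Q v.
Proof. by rewrite -scaleN1r wnorm2Z sqrrN expr1n mul1r. Qed.

Lemma wnorm2_scalel n (a : R) (Q : 'M[R]_n) v : wnorm2 (a *: Q) v = a * wnorm2 Q v.
Proof. by rewrite /wnorm2 -scalemxAl dotvZl. Qed.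

Lemma wnorm2B n (A B : 'M[R]_n) v : wnorm2 (A - B) v = wnorm2 A v - wnorm2 B v.
Proof. by rewrite /wnorm2 mulmxBl dotvDl dotvNl. Qed.

Lemma wnorm2_scalar n (a : R) (v : 'cV_n) : wnorm2 a%:M v = a * dotv v v.
Proof. by rewrite /wnorm2 mul_scalar_mx dotvZl. Qed.

Lemma wnorm2_mul m n (Q : 'M[R]_m) (A : 'M[R]_(m, n)) v :
  wnorm2 Q (A *m v) = wnorm2 (A^T *m Q *m A) v.
Proof. by rewrite /wnorm2 -!mulmxA [in RHS]dotv_mull trmxK. Qed.

Lemma normM_coord_le_dotv n (v : 'cV[R]_n) i j : `|v i 0 * v j 0| <= dotv v v.
Proof.
have dv k : v k 0 ^+ 2 <= dotv v v.
  rewrite /dotv (bigD1 k)//= -expr2 lerDl; apply: sumr_ge0 => h _.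
  exact: sqr_ge0.
rewrite ler_norml; move: (dv i) (dv j); set a := v i 0; set b := v j 0 => ? ?.
by apply/andP; split; nra.
Qed.

(** Each product of two coordinates is at most [dotv v v], so the sum of the absolute entries of [Q]
    works; adding 1 keeps [C] positive even for [Q = 0]. *)
Lemma wnorm2_le n (Q : 'M[R]_n) :
  exists2 C : R, 0 < C & forall v, wnorm2 Q v <= C * dotv v v.
Proof.
exists (1 + \sum_i \sum_j `|Q i j|) => [|v].
  rewrite ltr_pwDl//; apply: sumr_ge0 => i _; apply: sumr_ge0 => j _.
  exact: normr_ge0.
rewrite mulrDl mul1r ler_wpDl ?dotv_ge0// wnorm2E mulr_suml.
apply: ler_sum => i _; rewrite mulr_suml; apply: ler_sum => j _.
by rewrite (le_trans (ler_norm _))// normrM ler_wpM2l// normM_coord_le_dotv.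
Qed.

(** Discriminant argument: the form at [u + t *: v] is a nonnegative polynomial of degree at most
    two in [t]. *)
Lemma psd_cauchy_schwarz n (B : 'M[R]_n) u v : is_psd B ->
  dotv (B *m u) v ^+ 2 <= wnorm2 B u * wnorm2 B v.
Proof.
move=> [Bsym Bpos].
have q t : 0 <= wnorm2 B u + 2 * t * dotv (B *m u) v + t ^+ 2 * wnorm2 B v.
  have := Bpos (u + t *: v); rewrite mulmxDr -scalemxAr !(dotvDl, dotvDr).
  rewrite !(dotvZl, dotvZr) (_ : dotv (B *m v) u = dotv (B *m u) v).
    by rewrite /wnorm2; lra.
  by rewrite dotv_mull Bsym dotvC.
have {}Bpos w : 0 <= wnorm2 B w by exact: Bpos.
move: (Bpos v) q; set a := wnorm2 B u; set b := dotv _ _; set c := wnorm2 B v.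
rewrite le_eqVlt => /predU1P[<-|c0] q.
  have [->|b0] := eqVneq b 0; first by rewrite expr0n mulr0.
  (* Here the polynomial is affine with slope [2 * b]; this [t] gives it the value -1. *)
  have := q (- (a + 1) / (2 * b)).
  rewrite (_ : a + _ + _ = -1); last by field.
  by rewrite ler0N1.
(* The minimizer of the quadratic. *)
have := q (- b / c).
rewrite (_ : a + _ + _ = (a * c - b ^+ 2) / c); last by field; rewrite gt_eqF.
by rewrite pmulr_lge0 ?invr_gt0// subr_ge0.
Qed.

(* Cauchy-Schwarz for the form of [B], applied to [v] and [B^-1 v]. *)
Lemma psd_unit_coercive n (B : 'M[R]_n) : is_psd B -> B \in unitmx ->
  exists2 e : R, 0 < e & forall v, e * dotv v v <= wnorm2 B v.
Proof.
move=> Bpsd Bu; have [C C0 CB] := wnorm2_le (invmx B).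
exists C^-1 => [|v]; first by rewrite invr_gt0.
have [->|v0] := eqVneq v 0.
  by rewrite /wnorm2 mulmx0 -(scale0r (0 : 'cV[R]_n)) !dotvZl !mul0r mulr0.
have := psd_cauchy_schwarz v (invmx B *m v) Bpsd.
rewrite [wnorm2 B (_ *m _)]/wnorm2 mulKVmx// dotv_mull Bpsd.1 mulKVmx//.
rewrite [dotv v (invmx B *m v)]dotvC => h.
have vv := dotv_gt0 v0; have Bv := Bpsd.2 v.
rewrite ler_pdivrMl//.
have /(le_trans h) : wnorm2 B v * wnorm2 (invmx B) v <= wnorm2 B v * (C * dotv v v).
  by rewrite ler_wpM2l.
by rewrite mulrA expr2 ler_pM2r// mulrC.
Qed.

Lemma pd_unitmx n (A : 'M[R]_n) : is_pd A -> A \in unitmx.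
Proof.
move=> [Asym Apos]; rewrite -row_free_unit -kermx_eq0; apply/negPn/negP.
move=> /rowV0Pn[v /sub_kermxP vA v0].
have := Apos v^T; rewrite -trmx_eq0 trmxK => /(_ v0).
by rewrite -{1}Asym -trmx_mul vA trmx0 -(scale0r (0 : 'cV[R]_n)) dotvZl mul0r ltxx.
Qed.

(* The least [a] with [a I - A] positive semidefinite is an eigenvalue, since
   otherwise [a I - A] would be coercive. *)
Lemma wnorm2_le_lambda_max n (A : 'M[R]_n) v : A^T = A ->
  wnorm2 A v <= lambda_max A * dotv v v.
Proof.
move=> Asym.
case: n A v Asym => [|n] A v Asym; first by rewrite /wnorm2 /dotv !big_ord0 mulr0.
pose E := [set a : R | forall v, wnorm2 A v <= a * dotv v v].
have [C C0 CA] := wnorm2_le A.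
have E0 : E !=set0 by exists C.
have d0 : dotv (delta_mx 0 0 : 'cV[R]_n.+1) (delta_mx 0 0) = 1.
  rewrite /dotv (bigD1 0)//= !mxE !eqxx mulr1 big1 ?addr0// => i i0.
  by rewrite !mxE (negbTE i0) mul0r.
have Elb : has_lbound E.
  exists (wnorm2 A (delta_mx 0 0)) => a /(_ (delta_mx 0 0)).
  by rewrite d0 mulr1.
have Einf : E (inf E).
  move=> u; have [->|u0] := eqVneq u 0.
    by rewrite /wnorm2 mulmx0 -(scale0r (0 : 'cV[R]_n.+1)) !dotvZl !mul0r mulr0.
  rewrite -ler_pdivrMr ?dotv_gt0//; apply: lb_le_inf => // a Ea.
  by rewrite ler_pdivrMr ?dotv_gt0//; exact: Ea.
pose B := (inf E)%:M - A.
have Bq u : wnorm2 B u = inf E * dotv u u - wnorm2 A u.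
  by rewrite wnorm2B wnorm2_scalar.
have Bpsd : is_psd B.
  split; first by rewrite /B linearB /= tr_scalar_mx Asym.
  by move=> u; rewrite -/(wnorm2 B u) Bq subr_ge0; exact: Einf.
have eig : eigenvalue A (inf E).
  rewrite /eigenvalue /eigenspace kermx_eq0 row_free_unit; apply/negP => Bu.
  have {}Bu : B \in unitmx by rewrite /B -opprB -scaleN1r unitmxZ// unitrN1.
  have [e e0 Be] := psd_unit_coercive Bpsd Bu.
  have /(ge_inf Elb) : E (inf E - e).
    by move=> u; rewrite mulrBl; have := Be u; rewrite Bq; lra.
  by rewrite lerBrDl gerDr leNgt e0.
rewrite (le_trans (Einf v))// ler_wpM2r ?dotv_ge0//.
(* [sup] is meaningful only for a set bounded above: testing [Einf] on an eigenvector shows that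
   [inf E] bounds every eigenvalue. Eigenvectors are rows here, and symmetry of [A] turns them into
   columns. *)
apply: ub_le_sup => //; exists (inf E) => a /eigenvalueP[w wA w0].
have w0' : w^T != 0 by rewrite trmx_eq0.
have := Einf w^T; rewrite /wnorm2 -{1}Asym -trmx_mul wA linearZ /= dotvZl.
by rewrite ler_pM2r ?dotv_gt0.
Qed.

End Dotv.

(** * Measurability of random vectors, gradients and iterates *)

Section Measurability.
Context {R : realType} {dT : measure_display} {T : measurableType dT}.

Lemma measurable_preimage_countable (Q : countType) (Z : T -> Q) (A : set Q) :
  (forall q, measurable (Z @^-1` [set q])) -> measurable (Z @^-1` A).
Proof.
move=> mZ; rewrite (_ : Z @^-1` A = \bigcup_q (Z @^-1` (A `&` [set q]))).
  apply: countable_bigcupT_measurable => // q.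
  have [Aq|nAq] := pselect (A q).
    by rewrite (_ : A `&` _ = [set q])//; apply/seteqP; split=> [? []//|? ->].
  rewrite (_ : A `&` _ = set0) ?preimage_set0//; apply/seteqP.
  by split=> [? [? e]|//]; apply: nAq; rewrite -e.
by apply/seteqP; split=> [w Aw|w [q _ []]//]; exists (Z w).
Qed.

(* [X] is rounded to a grid of mesh [1 / m.+1], where it takes countably many
   values. *)
Lemma measurable_fun_comp_continuous n (h : 'cV[R]_n -> R) (X : T -> 'cV[R]_n) :
  continuous h -> random_mx X -> measurable_fun setT (h \o X).
Proof.
move=> ch mX.
pose r m w : 'cV[int]_n := \col_a Num.floor (m.+1%:R * X w a 0).
pose s m (z : 'cV[int]_n) : 'cV[R]_n := \col_a ((z a 0)%:~R / m.+1%:R).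
apply: (@measurable_fun_cvg _ _ _ _ (fun m w => h (s m (r m w)))) => [m|w _].
  move=> _ B mB; rewrite setTI.
  (* The rounded map factors through the countable type of integer vectors, so it is enough that the
     fibres of [r m] are measurable; each one is a finite intersection of preimages of half-open
     intervals. *)
  apply: (@measurable_preimage_countable _ (r m) [set z | B (h (s m z))]) => q.
  rewrite (_ : _ @^-1` _ = \bigcap_(a in setT)
     [set w | Num.floor (m.+1%:R * X w a 0) = q a 0]); last first.
    apply/seteqP; split=> [w /= <- a _|w /= rq]; first by rewrite /= mxE.
    by apply/colP => a; rewrite mxE; exact: rq.
  apply: fin_bigcap_measurable => // a _.
  rewrite (_ : [set _ | _] = (fun w => m.+1%:R * X w a 0) @^-1`
    `[(q a 0)%:~R, (q a 0 + 1)%:~R[%classic); last first.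
    apply/seteqP; split=> w /=; rewrite in_itv /=.
      by move=> <-; exact: floor_itv.
    by move/floor_def.
  rewrite -[X in _ X]setTI.
  have : measurable_fun setT (fun w => m.+1%:R * X w a 0).
    by apply: measurable_funM => //; exact: mX.
  by apply.
apply: (@cvg_comp _ _ _ (fun m => s m (r m w)) h _ (nbhs (X w))); last exact: ch.
apply/cvg_ballP => e e0; near=> m.
split=> // a j; rewrite ord1 /ball /= !mxE.
have m0 : 0 < m.+1%:R :> R by [].
set y := X w a 0.
have := floor_itv (m.+1%:R * y); rewrite intrD; set q := (Num.floor _)%:~R => /andP[q1 q2].
have mq : y - q / m.+1%:R = (m.+1%:R * y - q) / m.+1%:R.
  by field; rewrite gt_eqF.
rewrite mq ger0_norm; last by rewrite divr_ge0 ?subr_ge0.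
have : m.+1%:R^-1 < e by near: m; exact: near_infty_natSinv_lt (PosNum e0).
apply: le_lt_trans; rewrite -[leRHS]mul1r ler_wpM2r ?invr_ge0//.
by rewrite lerBlDl ltW.
Unshelve. all: by end_near. Qed.

Lemma random_mx_mul m n p (A : T -> 'M[R]_(m, n)) (B : T -> 'M[R]_(n, p)) :
  random_mx A -> random_mx B -> random_mx (fun w => A w *m B w).
Proof.
move=> mA mB a b; under eq_fun do rewrite mxE.
by apply: measurable_sum => j; apply: measurable_funM.
Qed.

Lemma random_mx_cst m n (A : 'M[R]_(m, n)) : random_mx (fun _ : T => A).
Proof. by move=> a b; exact: measurable_cst. Qed.

Lemma random_mxD m n (A B : T -> 'M[R]_(m, n)) :
  random_mx A -> random_mx B -> random_mx (fun w => A w + B w).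
Proof.
by move=> mA mB a b; under eq_fun do rewrite mxE; exact: measurable_funD.
Qed.

Lemma random_mxB m n (A B : T -> 'M[R]_(m, n)) :
  random_mx A -> random_mx B -> random_mx (fun w => A w - B w).
Proof.
by move=> mA mB a b; under eq_fun do rewrite !mxE; exact: measurable_funB.
Qed.

(** [grad f] may be discontinuous, so each partial derivative is taken as the pointwise limit of
    difference quotients of step [m.+1%:R^-1], which are measurable since [f] is continuous. *)
Lemma random_mx_grad n (f : 'cV[R]_n -> R) (X : T -> 'cV[R]_n) :
  (forall x, differentiable f x) -> random_mx X ->
  random_mx (fun w => grad f (X w)).
Proof.
move=> df mX a b.
have cf : continuous f by move=> x; exact: differentiable_continuous.
pose e : 'cV[R]_n := delta_mx a 0.
apply: (@measurable_fun_cvg _ _ _ _ (fun m w =>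
  (m.+1%:R^-1)^-1 * (f (m.+1%:R^-1 *: e + X w) - f (X w)))) => [m|w _].
  apply: measurable_funM => //; apply: measurable_funB;
    last exact: measurable_fun_comp_continuous.
  apply: (@measurable_fun_comp_continuous _ f (fun w => m.+1%:R^-1 *: e + X w)) => //.
  exact: random_mxD (@random_mx_cst _ _ _) mX.
rewrite mxE -deriveE//.
have /cvg_ex[y fy] : derivable f (X w) e by exact: diff_derivable.
have -> : 'D_e f (X w) = y by apply/cvg_lim.
apply: (@cvg_comp _ _ _ (fun m : nat => m.+1%:R^-1 : R)
  (fun t => t^-1 * (f (t *: e + X w) - f (X w))) _ 0^'); last exact: fy.
move=> A A0; have [N _ h0] := @cvg_harmonic R _ A0; exists N => // m /h0.
by apply; rewrite gt_eqF// invr_gt0.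
Qed.

(** Measurability is asked only below index [k], so that [T] may carry the sigma-algebra generated
    by the past alone. *)
Lemma random_mx_iterate n (f : 'cV[R]_n -> R) (D : 'M[R]_n)
    (Y : nat -> T -> 'M[R]_n) x0 k :
  (forall x, differentiable f x) -> (forall j, (j < k)%N -> random_mx (Y j)) ->
  random_mx (iterate f D Y x0 k).
Proof.
move=> df; elim: k => [_|k IH mY] /=; first exact: random_mx_cst.
have mx : random_mx (iterate f D Y x0 k) by apply: IH => j jk; apply/mY/ltnW.
apply: random_mxB => //; apply: random_mx_mul; last exact: random_mx_grad.
by apply: random_mx_mul; [exact: random_mx_cst|exact: mY].
Qed.

End Measurability.

(** * Independence of sigma-algebras and the product rule for expectations *)

Section Independence.
Context {R : realType} {dT : measure_display} {T : measurableType dT}.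
Context (P : probability T R).

(** For fixed [B], the finite measures sending [A] to [P (A]&[B)] and to [P A * P B] agree on the
    pi-system [G], hence on the sigma-algebra it generates. *)
Lemma indep_g_sigma_algebral (G : set (set T)) (B : set T) :
  G `<=` measurable -> setI_closed G -> G setT -> measurable B ->
  (forall A, G A -> P (A `&` B) = P A * P B)%E ->
  forall A, <<s G >> A -> (P (A `&` B) = P A * P B)%E.
Proof.
move=> Gm GI GT mB GB A sA.
have PB0 : 0 <= fine (P B) by exact: fine_ge0.
have PBE : (fine (P B))%:E = P B by rewrite fineK// fin_num_measure.
have scaleE C : mscale (NngNum PB0) P C = (P C * P B)%E.
  by rewrite /mscale /= PBE muleC.
rewrite -scaleE; apply: (@g_sigma_algebra_measure_unique _ R T G Gm (fun=> setT)
  (fun=> GT) _ (mrestr P mB) (mscale (NngNum PB0) P) GI _ _ A sA).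
- by rewrite bigcup_const//; exists 0%N.
- by move=> C /GB CB; rewrite [RHS]scaleE.
- move=> _; rewrite (_ : _ setT = P (setT `&` B))// setTI.
  by rewrite ltey_eq fin_num_measure.
Qed.

Lemma indep_g_sigma_algebra (G1 G2 : set (set T)) :
  G1 `<=` measurable -> setI_closed G1 -> G1 setT ->
  G2 `<=` measurable -> setI_closed G2 -> G2 setT ->
  (forall A B, G1 A -> G2 B -> P (A `&` B) = P A * P B)%E ->
  forall A B, <<s G1 >> A -> <<s G2 >> B -> (P (A `&` B) = P A * P B)%E.
Proof.
move=> m1 I1 T1 m2 I2 T2 h A B sA sB.
have mA : measurable A.
  by apply: smallest_sub sA => //; exact: sigma_algebra_measurable.
rewrite setIC muleC; apply: indep_g_sigma_algebral sB => // C GC.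
rewrite setIC muleC; apply: indep_g_sigma_algebral sA => //; first exact: m2.
by move=> D GD; exact: h.
Qed.

Definition indep_rv (U V : T -> R) := forall A B, measurable A -> measurable B ->
  (P (U @^-1` A `&` V @^-1` B) = P (U @^-1` A) * P (V @^-1` B))%E.

(** Under independence the law of the pair is the product of the two laws, so Fubini applies to
    [z.1 * z.2]. *)
Lemma indep_integrableM (U V : T -> R) : indep_rv U V ->
  P.-integrable setT (EFin \o U) -> P.-integrable setT (EFin \o V) ->
  P.-integrable setT (fun w => (U w * V w)%:E) /\
  (\int[P]_w (U w * V w)%:E = \int[P]_w (U w)%:E * \int[P]_w (V w)%:E)%E.
Proof.
move=> UV iU iV.
have mU : measurable_fun setT U by apply/measurable_EFinP; exact: measurable_int iU.
have mV : measurable_fun setT V by apply/measurable_EFinP; exact: measurable_int iV.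
pose X : {RV P >-> R} := HB.pack U (isMeasurableFun.Build _ _ _ _ _ mU).
pose Y : {RV P >-> R} := HB.pack V (isMeasurableFun.Build _ _ _ _ _ mV).
have mXY : measurable_fun setT (fun w => (U w, V w)).
  exact: measurable_fun_pair.
pose XY : {mfun T >-> (R * R)%type} :=
  HB.pack (fun w => (U w, V w)) (isMeasurableFun.Build _ _ _ _ _ mXY).
pose m := (distribution P X \x distribution P Y)%E.
have mE A : measurable A -> m A = pushforward P XY A.
  by move=> mA; apply: product_measure_unique => // B C mB mC; exact: UV.
pose h (z : R * R) := (z.1 * z.2)%:E.
have mh : measurable_fun setT h.
  apply/measurable_EFinP; apply: measurable_funM.
    exact: measurable_fst.
  exact: measurable_snd.
have absfin (Z : {RV P >-> R}) : P.-integrable setT (EFin \o Z) ->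
    (\int[distribution P Z]_x `|x%:E| < +oo)%E.
  move=> /integrableP[_]; rewrite ge0_integral_distribution//.
  by apply: measurableT_comp => //; exact: EFin_measurable.
(* By Tonelli, the integral of the absolute value is the product of the two first absolute
   moments. *)
have ih : m.-integrable setT h.
  apply/integrable12ltyP => //.
  under eq_integral => x _.
    under eq_integral do rewrite /h /= normrM EFinM.
    rewrite ge0_integralZl//; last by apply/measurable_EFinP.
    over.
  rewrite ge0_integralZr//=; last 2 first.
  - by apply/measurable_EFinP.
  - exact: integral_ge0.
  by apply: lte_mul_pinfty; [exact: integral_ge0| |exact: (absfin Y)];
     rewrite ge0_fin_numE; [exact: (absfin X)|exact: integral_ge0].
have ihXY : P.-integrable setT (h \o XY).
  apply/integrableP; split; first exact: measurableT_comp.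
  move/integrableP: ih => [_]; apply: le_lt_trans.
  rewrite (@eq_measure_integral _ _ _ _ (pushforward P XY)).
    by rewrite ge0_integral_pushforward//; exact: measurableT_comp.
  by move=> A mA _; exact: mE.
split => //.
transitivity (\int[m]_z h z)%E.
  rewrite [RHS](@eq_measure_integral _ _ _ _ (pushforward P XY)).
    by rewrite integral_pushforward.
  by move=> A mA _; exact: mE.
rewrite -integral12_prod_meas1//.
have iY : (distribution P Y).-integrable setT EFin.
  exact: (@integrable_pushforward _ _ _ _ _ Y).
have iX : (distribution P X).-integrable setT EFin.
  exact: (@integrable_pushforward _ _ _ _ _ X).
rewrite /fubini_F.
under eq_integral => x _.
  under eq_integral do rewrite /h /= EFinM.
  rewrite integralZl//.
  rewrite -[X in (_ * X)%E]fineK; last exact: integrable_fin_num.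
  over.
rewrite integralZr//= fineK; last exact: integrable_fin_num.
by rewrite !integral_distribution.
Qed.

End Independence.

(** * Cylinder events of a sequence of random matrices *)

Section Cylinders.
Context {R : realType} {dT : measure_display} {T : measurableType dT}.
Context (P : probability T R) (m n : nat) (Y : nat -> T -> 'M[R]_(m, n)).

(** The pi-system generating the sigma-algebra of the matrices [Y k] with [k \in s], in the shape of
    the events of [mx_mutually_independent]. *)
Definition cylinders (s : seq nat) : set (set T) :=
  [set A | exists B : nat -> 'I_m -> 'I_n -> set R,
    (forall k a b, measurable (B k a b)) /\
    A = [set w | forall k, k \in s -> mx_event (Y k) (B k) w]].

Lemma cylinders_setI_closed s : setI_closed (cylinders s).
Proof.
move=> _ _ [B [mB ->]] [C [mC ->]].
exists (fun k a b => B k a b `&` C k a b); split.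
  by move=> k a b; exact: measurableI.
apply/seteqP; split=> w /=.
  by move=> [Bw Cw] k ks a b; split; [exact: Bw|exact: Cw].
by move=> BC; split=> k ks a b; have [] := BC k ks a b.
Qed.

Lemma cylinders_setT s : cylinders s setT.
Proof. by exists (fun _ _ _ => setT); split=> //; apply/seteqP; split. Qed.

Lemma cylinders_measurable s : (forall k, random_mx (Y k)) ->
  cylinders s `<=` measurable.
Proof.
move=> mY _ [B [mB ->]].
rewrite (_ : [set _ | _] = \bigcap_(k in [set` s]) \bigcap_(a in setT)
    \bigcap_(b in setT) ((fun w => Y k w a b) @^-1` B k a b)); last first.
  apply/seteqP; split=> w /= h k ks; last by move=> a b; apply: h.
  by move=> a _ b _; exact: h.
apply: fin_bigcap_measurable => // k _; apply: fin_bigcap_measurable => // a _.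
apply: fin_bigcap_measurable => // b _.
by rewrite -[X in _ X]setTI; exact: mY.
Qed.

Lemma random_mx_cylinders s k : k \in s ->
  random_mx (Y k : g_sigma_algebraType (cylinders s) -> _).
Proof.
move=> ks a b _ C mC; apply: sub_sigma_algebra.
(* The cylinder that constrains a single entry of a single matrix. *)
exists (fun k' a' b' => if [&& k' == k, a' == a & b' == b] then C else setT).
split=> [k' a' b'|]; first by case: ifP.
apply/seteqP; split=> w /=.
  by move=> [_ Cw] k' _ a' b'; case: ifPn => // /and3P[/eqP-> /eqP-> /eqP->].
by move/(_ k ks a b); rewrite !eqxx.
Qed.

Lemma cylinders_indep s t : mx_mutually_independent P Y -> uniq (s ++ t) ->
  forall A B, cylinders s A -> cylinders t B -> (P (A `&` B) = P A * P B)%E.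
Proof.
move=> indY ust _ _ [B [mB ->]] [C [mC ->]].
have := ust; rewrite cat_uniq => /and3P[us /hasPn st ut].
(* Since [s] and [t] are disjoint, both families of constraints merge into one cylinder over
   [s ++ t], whose product splits accordingly. *)
pose E k := if k \in s then B k else C k.
rewrite (_ : _ `&` _ = [set w | forall k, k \in s ++ t -> mx_event (Y k) (E k) w]).
  rewrite !indY//; last by move=> k a b; rewrite /E; case: ifP.
  rewrite big_cat /=; congr (_ * _)%E; apply: eq_big_seq => k; rewrite /E.
    by move=> ->.
  by move=> /st /negbTE ->.
apply/seteqP; split=> w /=.
  move=> [Bw Cw] k; rewrite mem_cat /E; case: ifPn => [ks _|_ /= kt].
    exact: Bw.
  exact: Cw.
move=> Ew; split=> k ks; have := Ew k; rewrite mem_cat ks ?orbT /E.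
  by rewrite ks => /(_ isT).
by have /negbTE -> := st _ ks => /(_ isT).
Qed.

(** The form used in the descent step: [s] will be the present index and [t] the past ones. The
    dependence of [U] and [V] on disjoint groups of matrices is encoded by measurability for the
    generated sigma-algebras. *)
Lemma cylinders_indep_fun s t (U V : T -> R) :
  mx_mutually_independent P Y -> (forall k, random_mx (Y k)) -> uniq (s ++ t) ->
  measurable_fun setT (U : g_sigma_algebraType (cylinders s) -> R) ->
  measurable_fun setT (V : g_sigma_algebraType (cylinders t) -> R) ->
  indep_rv P U V.
Proof.
move=> indY mY ust mU mV A B mA mB.
apply: (@indep_g_sigma_algebra _ _ _ _ (cylinders s) (cylinders t)).
- exact: cylinders_measurable.
- exact: cylinders_setI_closed.
- exact: cylinders_setT.
- exact: cylinders_measurable.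
- exact: cylinders_setI_closed.
- exact: cylinders_setT.
- exact: cylinders_indep.
- by have := mU measurableT A mA; rewrite setTI.
- by have := mV measurableT B mB; rewrite setTI.
Qed.

End Cylinders.

(** * Integrability and entrywise expectations *)

Section Expectation.
Context {R : realType} {dT : measure_display} {T : measurableType dT}.
Context (P : probability T R).
Local Notation integ F := (P.-integrable setT (fun w => (F w)%:E)).
Implicit Types F G : T -> R.

Lemma integrable_RD F G : integ F -> integ G -> integ (fun w => F w + G w).
Proof. exact: integrableD. Qed.

Lemma integrable_RB F G : integ F -> integ G -> integ (fun w => F w - G w).
Proof. exact: integrableB. Qed.

Lemma integrable_RZl r F : integ F -> integ (fun w => r * F w).
Proof. exact: integrableZl. Qed.

Lemma integrable_Rsum (I : finType) (F : I -> T -> R) :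
  (forall i, integ (F i)) -> integ (fun w => \sum_i F i w).
Proof.
move=> iF; under eq_fun do rewrite -sumEFin.
exact: integrable_sum.
Qed.

Lemma Rintegral_sum (I : finType) (F : I -> T -> R) :
  (forall i, integ (F i)) ->
  Rintegral P setT (fun w => \sum_i F i w) = \sum_i Rintegral P setT (F i).
Proof.
move=> iF; rewrite /Rintegral; under eq_integral do rewrite -sumEFin.
by rewrite integral_sum// -sum_fine// => i _; exact: integrable_fin_num.
Qed.

Lemma integrable_Rle F G : measurable_fun setT F ->
  (forall w, `|F w| <= `|G w|) -> integ G -> integ F.
Proof.
move=> mF FG; apply: le_integrable => //; first exact/measurable_EFinP.
by move=> w _; rewrite /= lee_fin.
Qed.

Lemma EmxE m n (X : T -> 'M[R]_(m, n)) a b :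
  Emx P X a b = Rintegral P setT (fun w => X w a b).
Proof. by rewrite mxE unlock. Qed.

Definition integrable_mx m n (X : T -> 'M[R]_(m, n)) :=
  forall a b, integ (fun w => X w a b).

Lemma Emx_mull m n p (A : 'M[R]_(m, n)) (X : T -> 'M[R]_(n, p)) :
  integrable_mx X -> integrable_mx (fun w => A *m X w) /\
  Emx P (fun w => A *m X w) = A *m Emx P X.
Proof.
move=> iX.
have iAX a b j : integ (fun w => A a j * X w j b) by exact: integrable_RZl.
split=> [a b|]; first by under eq_fun do rewrite mxE; exact: integrable_Rsum.
apply/matrixP => a b; rewrite EmxE mxE.
under eq_Rintegral do rewrite mxE; rewrite Rintegral_sum//.
by apply: eq_bigr => j _; rewrite RintegralZl ?EmxE//; exact: iX.
Qed.

Lemma Emx_tr m n (X : T -> 'M[R]_(m, n)) : Emx P (fun w => (X w)^T) = (Emx P X)^T.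
Proof.
apply/matrixP => a b; rewrite [RHS]mxE !EmxE; apply: eq_Rintegral => w _.
by rewrite mxE.
Qed.

Lemma Emx_mulr m n p (X : T -> 'M[R]_(m, n)) (A : 'M[R]_(n, p)) :
  integrable_mx X -> integrable_mx (fun w => X w *m A) /\
  Emx P (fun w => X w *m A) = Emx P X *m A.
Proof.
move=> iX.
have [|i1 e1] := @Emx_mull _ _ _ A^T (fun w => (X w)^T).
  by move=> a b; under eq_fun do rewrite mxE.
have XA : (fun w => X w *m A) = (fun w => (A^T *m (X w)^T)^T).
  by apply/funext => w; rewrite trmx_mul !trmxK.
split=> [a b|].
  have := i1 b a; congr (P.-integrable _ _); apply/funext => w.
  by rewrite -trmx_mul mxE.
by rewrite XA Emx_tr e1 Emx_tr trmx_mul !trmxK.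
Qed.

(** This stands in for conditioning on [g]: the form is a sum of an entry of [M] times a product of
    two coordinates of [g], and the product rule applies to each term. *)
Lemma Rintegral_wnorm2_indep n (M : T -> 'M[R]_n) (g : T -> 'cV[R]_n) :
  integrable_mx M -> (forall a b, integ (fun w => g w b 0 * g w a 0)) ->
  (forall a b, indep_rv P (fun w => M w a b) (fun w => g w b 0 * g w a 0)) ->
  integ (fun w => wnorm2 (M w) (g w)) /\
  Rintegral P setT (fun w => wnorm2 (M w) (g w)) =
  Rintegral P setT (fun w => wnorm2 (Emx P M) (g w)).
Proof.
move=> iM ig ind.
have iMg a b := indep_integrableM (ind a b) (iM a b) (ig a b).
have i1 a : integ (fun w => \sum_b M w a b * (g w b 0 * g w a 0)).
  by apply: integrable_Rsum => b; exact: (iMg a b).1.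
have i2 a b : integ (fun w => Emx P M a b * (g w b 0 * g w a 0)).
  exact: integrable_RZl.
split; first by under eq_fun do rewrite wnorm2E; exact: integrable_Rsum.
under eq_Rintegral do rewrite wnorm2E.
under [RHS]eq_Rintegral do rewrite wnorm2E.
rewrite !Rintegral_sum//; last by move=> a; exact: integrable_Rsum.
apply: eq_bigr => a _; rewrite !Rintegral_sum//; last by move=> b; exact: (iMg a b).1.
apply: eq_bigr => b _; rewrite RintegralZl ?EmxE//; last exact: ig.
rewrite [LHS]/Rintegral (iMg a b).2 fineM//; exact: integrable_fin_num.
Qed.

Lemma integrable_wnorm2 n (M : 'M[R]_n) (g : T -> 'cV[R]_n) :
  (forall a b, integ (fun w => g w b 0 * g w a 0)) ->
  integ (fun w => wnorm2 M (g w)).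
Proof.
move=> ig; under eq_fun do rewrite wnorm2E.
by apply: integrable_Rsum => a; apply: integrable_Rsum => b; exact: integrable_RZl.
Qed.

End Expectation.

(** * Block-diagonal matrices acting on blocks of vectors *)

Section Blocks.
Context {R : realType} {l : nat} {d : 'I_l -> nat}.
Local Notation N := (\sum_i d i)%N.

Lemma dotv_submxcol (u v : 'cV[R]_N) :
  dotv u v = \sum_i dotv (submxcol u i) (submxcol v i).
Proof.
rewrite dotvE -{1}(submxcolK u) -{1}(submxcolK v) tr_mxcol mul_mxrow_mxcol.
by rewrite summxE; apply: eq_bigr => i _; rewrite dotvE.
Qed.

Lemma submxcol_mxdiag_mul (D : forall i, 'M[R]_(d i)) (v : 'cV[R]_N) i :
  submxcol (\mxdiag_i D i *m v) i = D i *m submxcol v i.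
Proof. by rewrite -{1}(submxcolK v) mul_mxdiag_mxcol mxcolK. Qed.

Lemma wnorm2_mxdiag (D : forall i, 'M[R]_(d i)) (v : 'cV[R]_N) :
  wnorm2 (\mxdiag_i D i) v = \sum_i wnorm2 (D i) (submxcol v i).
Proof.
by rewrite /wnorm2 dotv_submxcol; apply: eq_bigr => i _; rewrite submxcol_mxdiag_mul.
Qed.

Lemma submxblock_mxdiag (D : forall i, 'M[R]_(d i)) i :
  submxblock (\mxdiag_i D i) i i = D i.
Proof. by rewrite /mxdiag mxblockK eqxx conform_mx_id. Qed.

End Blocks.

(** * Deterministic descent estimates and the step-size condition *)

Section Step.
Context {R : realType}.

(** With [C] bounding the form of [L], a step of length [C^-1] against the gradient lowers [f] by at
    least [dotv g g / (2 * C)], yet the value stays above [finf]. *)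
Lemma grad_sqnorm_le n (f : 'cV[R]_n -> R) (finf : R) (L : 'M[R]_n) :
  (forall x, finf <= f x) ->
  (forall x y, f x <= f y + dotv (grad f y) (x - y) + 2^-1 * wnorm2 L (x - y)) ->
  exists2 C : R, 0 < C &
    forall x, dotv (grad f x) (grad f x) <= C * (f x - finf).
Proof.
move=> f_ge smooth; have [C C0 LC] := wnorm2_le L.
exists (2 * C) => [|x]; first by rewrite mulr_gt0.
set g := grad f x.
have := le_trans (f_ge _) (smooth (x - C^-1 *: g) x).
rewrite -/g [_ - x]addrC addKr dotvNr wnorm2N dotvZr wnorm2Z => h.
have h2 : C^-1 ^+ 2 * wnorm2 L g <= C^-1 * dotv g g.
  apply: (@le_trans _ _ (C^-1 ^+ 2 * (C * dotv g g))).
    by rewrite ler_wpM2l// exprn_ge0// invr_ge0 ltW.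
  by rewrite mulrA expr2 mulfVK ?gt_eqF.
have : C^-1 * dotv g g <= 2 * (f x - finf) by lra.
by rewrite ler_pdivrMl//; lra.
Qed.

Lemma smooth_step_le l (d : 'I_l -> nat) (f : 'cV[R]_(\sum_i d i) -> R)
    (L W S : forall i, 'M[R]_(d i)) (gamma : 'I_l -> R) x g :
  (forall i, (W i)^T = W i) -> (forall i, (S i)^T = S i) ->
  (forall x y, f x <= f y + dotv (grad f y) (x - y)
                     + 2^-1 * wnorm2 (\mxdiag_i L i) (x - y)) ->
  g = grad f x ->
  f (x - (\mxdiag_i (gamma i)%:M *m \mxdiag_i W i) *m \mxdiag_i S i *m g) <=
  f x - \sum_i gamma i * wnorm2 (W i *m S i) (submxcol g i)
  + 2^-1 * \sum_i gamma i ^+ 2 *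
      wnorm2 (S i *m W i *m L i *m W i *m S i) (submxcol g i).
Proof.
move=> Wsym Ssym smooth gE; set u := _ *m g.
have uE i : submxcol u i = gamma i *: ((W i *m S i) *m submxcol g i).
  by rewrite /u -!mulmxA !submxcol_mxdiag_mul mul_scalar_mx.
apply: le_trans (smooth _ x) _.
rewrite -gE [_ - x]addrC addKr dotvNr wnorm2N wnorm2_mxdiag dotv_submxcol.
(* Smoothness was the only inequality; what remains is the blockwise expansion of both terms through
   [uE]. *)
rewrite le_eqVlt; apply/orP; left; apply/eqP; congr (_ - _ + _ * _).
  by apply: eq_bigr => i _; rewrite uE dotvZr dotvC.
apply: eq_bigr => i _; rewrite uE wnorm2Z wnorm2_mul trmx_mul Wsym Ssym.
by rewrite !mulmxA.
Qed.

Context {dT : measure_display} {T : measurableType dT}.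

Lemma random_mx_mxdiag l (d : 'I_l -> nat) (S : forall i, T -> 'M[R]_(d i)) :
  (forall i, random_mx (S i)) -> random_mx (fun w => \mxdiag_i S i w).
Proof.
move=> mS s t; under eq_fun do rewrite mxE /tagnat.sig1 /tagnat.sig2.
case: (tagnat.sig s) (tagnat.sig t) => [/= i a] [/= j b].
case: eqP => [<-|_] in b *; first by under eq_fun do rewrite conform_mx_id; exact: mS.
by under eq_fun do rewrite mxE; exact: measurable_cst.
Qed.

Lemma random_mx_submxcol l (d : 'I_l -> nat) (g : T -> 'cV[R]_(\sum_i d i)) i :
  random_mx g -> random_mx (fun w => submxcol (g w) i).
Proof. by move=> mg a b; under eq_fun do rewrite mxE; exact: mg. Qed.

Context (P : probability T R).

(* Conjugating by [W^{1/2} = invmx Wih] turns the bound on the largest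
   eigenvalue into an operator inequality for [E[S W L W S]]. *)
Lemma Emx_sketch_le n (W Wih L : 'M[R]_n) (S : T -> 'M[R]_n) (gamma : R) :
  is_pd W -> is_pd Wih -> Wih *m Wih = invmx W -> L^T = L ->
  (forall w, (S w)^T = S w) -> 0 < gamma ->
  integrable_mx P (fun w => Wih *m S w *m W *m L *m W *m S w *m Wih) ->
  gamma <= (lambda_max (Emx P (fun w =>
              Wih *m S w *m W *m L *m W *m S w *m Wih)))^-1 ->
  integrable_mx P (fun w => S w *m W *m L *m W *m S w) /\
  forall v, gamma * wnorm2 (Emx P (fun w => S w *m W *m L *m W *m S w)) v
            <= wnorm2 W v.
Proof.
move=> Wpd Vpd VV Lsym Ssym g0.
set Z := (fun w => Wih *m _ *m _ *m _ *m _ *m _ *m Wih).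
move=> iZ gle.
have Vu := pd_unitmx Vpd; have Wu := pd_unitmx Wpd.
set H := invmx Wih.
have HZH : (fun w => S w *m W *m L *m W *m S w) = (fun w => H *m Z w *m H).
  by apply/funext => w; rewrite /Z !mulmxA mulVmx// mul1mx mulmxK.
have [i1 e1] := Emx_mull H iZ; have [i2 e2] := Emx_mulr H i1.
rewrite HZH e2 e1; split=> // v.
have Hsym : H^T = H by rewrite /H trmx_inv Vpd.1.
have HH : H *m H = W.
  have -> : H *m H = invmx (Wih *m Wih).
    apply: (can_inj (mulmxK (_ : Wih *m Wih \in unitmx))).
      by rewrite unitmx_mul Vu.
    rewrite [RHS]mulVmx ?unitmx_mul ?Vu// -mulmxA (mulmxA H Wih) [H *m Wih]mulVmx//.
    by rewrite mul1mx mulVmx.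
  by rewrite VV invmxK.
have Zsym : (Emx P Z)^T = Emx P Z.
  rewrite -Emx_tr; congr (Emx P _); apply/funext => w.
  by rewrite /Z !trmx_mul Vpd.1 Wpd.1 Lsym Ssym !mulmxA.
rewrite -{1}Hsym -wnorm2_mul.
have -> : wnorm2 W v = dotv (H *m v) (H *m v).
  by rewrite /wnorm2 -HH -mulmxA dotv_mull Hsym.
(* Positivity is forced by [0 < gamma] and the bound on [gamma], which rules out the default value
   of an inverse at 0. *)
have l0 : 0 < lambda_max (Emx P Z) by rewrite -invr_gt0 (lt_le_trans g0).
apply: (@le_trans _ _ (gamma * (lambda_max (Emx P Z) * dotv (H *m v) (H *m v)))).
  by rewrite ler_wpM2l ?(ltW g0)//; exact: wnorm2_le_lambda_max.
rewrite mulrA ler_piMl ?dotv_ge0//.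
by rewrite -ler_pdivlMr// div1r.
Qed.

End Step.

(** * Expected descent and telescoping *)

Theorem theorem2 (R : realType) (l : nat) (d : 'I_l -> nat)
  (f : 'cV[R]_(\sum_i d i) -> R) (finf : R)
  (L : forall i : 'I_l, 'M[R]_(d i))
  (dT : measure_display) (T : measurableType dT) (P : probability T R)
  (S : forall i : 'I_l, nat -> T -> 'M[R]_(d i))
  (W Wih : forall i : 'I_l, 'M[R]_(d i)) (gamma : 'I_l -> R)
  (x0 : 'cV[R]_(\sum_i d i)) (K : nat) :
  (* f differentiable, bounded below by finf *)
  (forall x, differentiable f x) ->
  (forall x, finf <= f x) ->
  (* block-diagonal L-smoothness, L_i symmetric positive definite *)
  (forall i, is_pd (L i)) ->
  (forall x y, f x <= f y + dotv (grad f y) (x - y)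
                     + 2^-1 * wnorm2 (\mxdiag_i L i) (x - y)) ->
  (* S_i^k random symmetric PSD matrices with finite expectation E[S_i^k] = I *)
  (forall i k, random_mx (S i k)) ->
  (forall i k w, is_psd (S i k w)) ->
  (forall i k a b, P.-integrable setT (fun w => (S i k w a b)%:E)) ->
  (forall i k, Emx P (S i k) = 1%:M) ->
  (* independence across k of S^k = Diag(S_1^k,...,S_l^k), and for each i the
     S_i^k are identically distributed *)
  mx_mutually_independent P (fun k w => \mxdiag_i S i k w) ->
  (forall i k, mx_same_law P (S i k) (S i 0)) ->
  (* W_i symmetric positive definite, Wih i = W_i^{-1/2} *)
  (forall i, is_pd (W i)) ->
  (forall i, is_pd (Wih i) /\ Wih i *m Wih i = invmx (W i)) ->
  (* step sizes *)
  (forall i, 0 < gamma i) ->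
  (forall i k a b, P.-integrable setT (fun w =>
      ((Wih i *m S i k w *m W i *m L i *m W i *m S i k w *m Wih i) a b)%:E)) ->
  (forall i k, gamma i <= (lambda_max (Emx P (fun w =>
      Wih i *m S i k w *m W i *m L i *m W i *m S i k w *m Wih i)))^-1) ->
  (0 < K)%N ->
  let Wm := \mxdiag_i W i in
  let Gm := \mxdiag_i (gamma i)%:M : 'M[R]_(\sum_i d i) in
  let Dm := Gm *m Wm in
  let c := powR (\det (Gm *m Wm)) ((\sum_i d i)%:R^-1) in
  let x := iterate f Dm (fun k w => \mxdiag_i S i k w) x0 in
  ((K%:R^-1)%:E * \sum_(k < K)
      'E_P[fun w => wnorm2 (c^-1 *: (Gm *m Wm)) (grad f (x k w))]
   <= (2 * (f x0 - finf) / (c * K%:R))%:E)%E.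
Proof.
move=> df f_ge Lpd smooth mS Spsd iS ES indS _ Wpd VW g0 iZ gle K0.
cbv zeta; set Wm := \mxdiag_i W i; set Gm := \mxdiag_i (gamma i)%:M.
set Y := (fun k w => \mxdiag_i S i k w) in indS *.
set c := powR _ _; set Dm := Gm *m Wm; set x := iterate f Dm Y x0.
have mY k : random_mx (Y k) by apply: random_mx_mxdiag => i; exact: mS.
have cf : continuous f by move=> y; exact: differentiable_continuous.
pose g k w := grad f (x k w); pose gi i k w := submxcol (g k w) i.
pose q k w := wnorm2 Dm (g k w).
have qE k w : q k w = \sum_i gamma i * wnorm2 (W i) (gi i k w).
  rewrite /q /wnorm2 dotv_submxcol; apply: eq_bigr => i _.
  by rewrite /Dm -mulmxA !submxcol_mxdiag_mul mul_scalar_mx dotvZl.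
have mx k : random_mx (x k) by apply: random_mx_iterate.
have mg k : random_mx (g k) by exact: random_mx_grad.
have mfx k : measurable_fun setT (fun w => f (x k w)).
  exact: measurable_fun_comp_continuous.
have [C C0 gC] := grad_sqnorm_le f_ge smooth.
have sketch i k := Emx_sketch_le (Wpd i) (VW i).1 (VW i).2 (Lpd i).1
  (fun w => (Spsd i k w).1) (g0 i) (iZ i k) (gle i k).
have EWS i k := Emx_mull (W i) (iS i k).
pose E F := Rintegral P setT F.
(* Integrability of [f (x k)] is both assumed and reproduced at [k.+1], so that the step can be
   iterated. *)
have step k : P.-integrable setT (fun w => (f (x k w))%:E) ->
    [/\ P.-integrable setT (fun w => (f (x k.+1 w))%:E),
        P.-integrable setT (fun w => (q k w)%:E) &
        E (fun w => f (x k.+1 w)) + 2^-1 * E (q k) <= E (fun w => f (x k w))].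
  move=> ifx.
  (* Dominated by the squared gradient norm, hence by [C * (f (x k w) - finf)]. *)
  have igg a b : P.-integrable setT (fun w => (g k w b 0 * g k w a 0)%:E).
    apply: (@integrable_Rle _ _ _ _ _ (fun w => C * (f (x k w) - finf))).
    - by apply: measurable_funM; exact: mg.
    - move=> w; rewrite [leRHS]ger0_norm; last first.
        by rewrite mulr_ge0 ?subr_ge0 ?(ltW C0).
      by apply: le_trans (gC _); exact: normM_coord_le_dotv.
    - apply: integrable_RZl; apply: integrable_RB => //.
      exact: finite_measure_integrable_cst.
  have iggi i a b : P.-integrable setT (fun w => (gi i k w b 0 * gi i k w a 0)%:E).
    have giE j w : gi i k w j 0 = g k w (tagnat.Rank i j) 0 by rewrite [LHS]mxE.
    by under eq_fun do rewrite !giE; exact: igg.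
  (* Two copies of [T], with the sigma-algebras of [Y 0], ..., [Y k.-1] (trivial for [k = 0]) and of
     [Y k]: the gradient is measurable for the first, the sketches for the second. *)
  pose Tpast := g_sigma_algebraType (cylinders Y (iota 0 k)).
  pose Tnow := g_sigma_algebraType (cylinders Y [:: k]).
  have mgi i : random_mx (gi i k : Tpast -> _).
    apply: random_mx_submxcol; apply: random_mx_grad => //.
    apply: random_mx_iterate => // j jk.
    by apply: random_mx_cylinders; rewrite mem_iota add0n.
  have mSi i : random_mx (S i k : Tnow -> _).
    move=> a b; have mYk : random_mx (Y k : Tnow -> _).
      by apply: random_mx_cylinders; rewrite inE.
    rewrite (_ : (fun w => _) = fun w => Y k w (tagnat.Rank i a) (tagnat.Rank i b)).
      exact: mYk.
    by apply/funext => w; rewrite -[in LHS](submxblock_mxdiag (fun i => S i k w) i) mxE.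
  have ind i (M : T -> 'M[R]_(d i)) : random_mx (M : Tnow -> _) ->
      forall a b, indep_rv P (fun w => M w a b) (fun w => gi i k w b 0 * gi i k w a 0).
    move=> mM a b; apply: (@cylinders_indep_fun _ _ _ _ _ _ Y [:: k] (iota 0 k)) => //.
    - by rewrite /= mem_iota add0n ltnn iota_uniq.
    - by apply: measurable_funM; exact: mgi.
  have ind1 i := Rintegral_wnorm2_indep (EWS i k).1 (iggi i)
    (ind i _ (random_mx_mul (@random_mx_cst _ _ Tnow _ _ (W i)) (mSi i))).
  have ind2 i : P.-integrable setT (fun w =>
        (wnorm2 (S i k w *m W i *m L i *m W i *m S i k w) (gi i k w))%:E) /\ _ :=
    Rintegral_wnorm2_indep (sketch i k).1 (iggi i)
    (ind i _ (random_mx_mul (random_mx_mul (random_mx_mul (random_mx_mul (mSi i)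
      (@random_mx_cst _ _ Tnow _ _ _)) (@random_mx_cst _ _ Tnow _ _ _))
      (@random_mx_cst _ _ Tnow _ _ _)) (mSi i))).
  have iq : P.-integrable setT (fun w => (q k w)%:E).
    exact: integrable_wnorm2.
  pose t1 w := \sum_i gamma i * wnorm2 (W i *m S i k w) (gi i k w).
  pose t2 w := \sum_i gamma i ^+ 2 *
      wnorm2 (S i k w *m W i *m L i *m W i *m S i k w) (gi i k w).
  have it1 : P.-integrable setT (fun w => (t1 w)%:E).
    by apply: integrable_Rsum => i; apply: integrable_RZl; exact: (ind1 i).1.
  have it2 : P.-integrable setT (fun w => (t2 w)%:E).
    by apply: integrable_Rsum => i; apply: integrable_RZl; exact: (ind2 i).1.
  have iW i : P.-integrable setT (fun w => (wnorm2 (W i) (gi i k w))%:E).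
    exact: integrable_wnorm2.
  (* Unbiasedness: the mean of [W i *m S i k w] is [W i]. *)
  have Et1 : E t1 = E (q k).
    rewrite /E (eq_Rintegral _ (fun w _ => qE k w)) !Rintegral_sum.
    - apply: eq_bigr => i _; rewrite [LHS]RintegralZl//; last exact: (ind1 i).1.
      rewrite [RHS]RintegralZl//; last exact: iW.
      by rewrite (ind1 i).2 (EWS i k).2 ES mulmx1.
    - by move=> i; apply: integrable_RZl.
    - by move=> i; apply: integrable_RZl; exact: (ind1 i).1.
  (* One of the two factors [gamma i] is absorbed by the step-size condition through [sketch]. *)
  have Et2 : E t2 <= E (q k).
    rewrite /E (eq_Rintegral _ (fun w _ => qE k w)) !Rintegral_sum.
    - apply: ler_sum => i _; rewrite [leLHS]RintegralZl//; last exact: (ind2 i).1.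
      rewrite [leRHS]RintegralZl//; last exact: iW.
      rewrite (ind2 i).2 expr2 -mulrA ler_wpM2l ?(ltW (g0 i))//.
      rewrite -RintegralZl//; last exact: integrable_wnorm2.
      apply: le_Rintegral => //.
      + by apply: integrable_RZl; exact: integrable_wnorm2.
      + exact: iW.
      + by move=> w _; exact: (sketch i k).2.
    - by move=> i; apply: integrable_RZl.
    - by move=> i; apply: integrable_RZl; exact: (ind2 i).1.
  have le1 w : f (x k.+1 w) <= f (x k w) - t1 w + 2^-1 * t2 w.
    apply: smooth_step_le => // i; first exact: (Wpd i).1.
    exact: (Spsd i k w).1.
  have iub : P.-integrable setT (fun w => (f (x k w) - t1 w + 2^-1 * t2 w)%:E).
    by apply: integrable_RD; [exact: integrable_RB|exact: integrable_RZl].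
  (* The new value lies between the constant [finf] and the integrable bound of [le1]. *)
  have ifx1 : P.-integrable setT (fun w => (f (x k.+1 w))%:E).
    apply: (@integrable_Rle _ _ _ _ _ (fun w =>
      `|f (x k w) - t1 w + 2^-1 * t2 w| + `|finf|)) => //.
      move=> w; rewrite [leRHS]ger0_norm ?addr_ge0// ler_norml.
      have := le1 w; have := f_ge (x k.+1 w).
      have := ler_norm (f (x k w) - t1 w + 2^-1 * t2 w).
      have := normr_ge0 (f (x k w) - t1 w + 2^-1 * t2 w).
      have := ler_norm (- finf); rewrite normrN; have := normr_ge0 finf.
      by move=> *; apply/andP; split; lra.
    apply: integrable_RD; last exact: finite_measure_integrable_cst.
    exact: (integrable_norm iub).
  split=> //.
  have : E (fun w => f (x k.+1 w)) <= E (fun w => f (x k w) - t1 w + 2^-1 * t2 w).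
    by apply: le_Rintegral.
  (* The linear term contributes [- E (q k)] and the quadratic one at most half of [E (q k)]. *)
  rewrite {2}/E RintegralD//; [|exact: integrable_RB|exact: integrable_RZl].
  rewrite RintegralB// RintegralZl// -!/(E _) Et1; lra.
have ifx k : P.-integrable setT (fun w => (f (x k w))%:E).
  by elim: k => [|k /step[]//]; exact: (finite_measure_integrable_cst P (f x0)).
have iq k : P.-integrable setT (fun w => (q k w)%:E) by have [] := step k (ifx k).
have Ecst r : E (fun=> r) = r.
  have P1 : fine (P setT) = 1 by rewrite probability_setT.
  by rewrite /E (Rintegral_cst P measurableT r) [X in r * X]P1 mulr1.
have tele n : E (fun w => f (x n w)) + 2^-1 * \sum_(k < n) E (q k) <= f x0.
  elim: n => [|n IH].
    by rewrite big_ord0 mulr0 addr0 [E _](Ecst (f x0)).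
  have [_ _] := step n (ifx n); rewrite big_ord_recr /= mulrDr; lra.
have sumq : \sum_(k < K) E (q k) <= 2 * (f x0 - finf).
  have := tele K; suff : finf <= E (fun w => f (x K w)) by lra.
  rewrite -[leLHS]Ecst; apply: le_Rintegral => //; last exact: ifx.
  exact: (finite_measure_integrable_cst P finf).
(* [c] enters both sides only through the factor [c^-1], so its sign is enough for the final
   comparison. *)
have c0 : 0 <= c by exact: powR_ge0.
(* Integrability makes the extended-real expectation finite, which reduces the claim to the real
   inequality [sumq]. *)
have EqE k : 'E_P[fun w => wnorm2 (c^-1 *: (Gm *m Wm)) (grad f (x k w))]%E
    = (c^-1 * E (q k))%:E.
  have icq : P.-integrable setT (fun w => (c^-1 * q k w)%:E).
    exact: integrable_RZl.
  rewrite unlock /E -RintegralZl//; last exact: iq.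
  rewrite /Rintegral fineK; last exact: integrable_fin_num icq.
  by apply: eq_integral => w _; rewrite wnorm2_scalel.
rewrite (eq_bigr (fun k : 'I_K => (c^-1 * E (q k))%:E) (fun k _ => EqE k)).
rewrite sumEFin -EFinM lee_fin -mulr_sumr invfM.
by rewrite mulrA (mulrC K%:R^-1) [leRHS]mulrC ler_wpM2l// mulr_ge0 ?invr_ge0.
Qed.
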